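(* Let $\mathscr{R}$ be a $\sigma$-algebra of subsets of a set $T$ and let $\mu,\nu$ be finite measures on $\mathscr{R}$ such that $\nu$ is absolutely continuous with respect to $\mu$. Let $\mathscr{D}$ be the space of $\mathscr{R}$-measurable simple functions, and let $J$ be the canonical embedding operator of $\mathscr{D}\subseteq\mathscr{L}^2(\mu)$ into $\mathscr{L}^2(\nu)$, $J\varphi=\varphi$ for $\varphi\in\mathscr{D}$, with adjoint $J^*$. Then the following assertions are equivalent: (i) the Radon–Nikodym derivative $\dfrac{d\nu}{d\mu}$ belongs to $\mathscr{L}^2(\mu)$; (ii) $1\in\operatorname{dom}J^*$; (iii) $\mathscr{D}\subseteq\operatorname{dom}J^*$; (iv) there is a constant $C\geq0$ such that $$\Big|\int_T\varphi\,d\nu\Big|^2\leq C\int_T|\varphi|^2\,d\mu,\qquad\varphi\in\mathscr{D}.$$ Whenever these equivalent assertions hold, $\dfrac{d\nu}{d\mu}=J^*1$.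
   Context: $\nu$ is absolutely continuous with respect to $\mu$ if $\mu(E)=0$ implies $\nu(E)=0$ for all $E\in\mathscr{R}$. In that case $J$ is a well-defined, densely defined linear operator from $\mathscr{L}^2(\mu)$ to $\mathscr{L}^2(\nu)$ with domain (the $\mu$-a.e. classes of) $\mathscr{D}$. The adjoint $J^*$ is the operator from $\operatorname{dom}J^*\subseteq\mathscr{L}^2(\nu)$ to $\mathscr{L}^2(\mu)$, where $g\in\operatorname{dom}J^*$ iff $\varphi\mapsto(J\varphi\,|\,g)_\nu=\int_T\varphi\overline{g}\,d\nu$ is continuous on $\mathscr{D}$ in the $\mathscr{L}^2(\mu)$-norm, and then $\int_T\varphi\overline{g}\,d\nu=\int_T\varphi\overline{J^*g}\,d\mu$ for all $\varphi\in\mathscr{D}$. *)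

(* Defs.v *)
(* MathComp-Analysis; complex scalars R[i] over R : realType from
   mathcomp-real-closed. *)
From HB Require Import structures.
From mathcomp Require Import all_boot all_order all_algebra.
From mathcomp Require Import complex.
From mathcomp Require Import all_classical all_reals all_analysis.
Import Order.TTheory GRing.Theory Num.Theory.

Set Implicit Arguments.
Unset Strict Implicit.
Unset Printing Implicit Defensive.

Local Open Scope classical_set_scope.
Local Open Scope ring_scope.
Local Open Scope complex_scope.
Local Open Scope charge_scope.

Section complex_L2.
Context d (T : measurableType d) (R : realType).
Implicit Types (mu nu : {measure set T -> \bar R}) (f g h phi psi : T -> R[i]).

(* `|z| for z : R[i] lives in R[i]; this is the modulus as an element of R. *)
Definition cabs (z : R[i]) : R := ComplexField.Normc.normc z.

(* The library has no sigma-algebra on R[i]; the Borel one is generated by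
   the real and imaginary parts. *)
Definition cmeasurable : set (T -> R[i]) :=
  [set f | measurable_fun [set: T] (fun x => complex.Re (f x)) /\
           measurable_fun [set: T] (fun x => complex.Im (f x))].

Definition csimple : set (T -> R[i]) :=
  [set f | cmeasurable f /\ finite_set (range f)].

Definition cintegral mu f : R[i] :=
  Rintegral mu [set: T] (fun x => complex.Re (f x)) +i*
  Rintegral mu [set: T] (fun x => complex.Im (f x)).

(* Members are functions representing the elements of the Hilbert space
   L2(mu); the elements themselves are the classes L2class mu f below. *)
Definition L2 mu : set (T -> R[i]) :=
  [set f | cmeasurable f /\
           (\int[mu]_(x in [set: T]) (cabs (f x) ^+ 2)%:E < +oo)%E].

Definition L2class mu f : set (T -> R[i]) :=
  [set h | L2 mu h /\ h = f %[ae mu]].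

Definition L2inner mu f g : R[i] := cintegral mu (fun x => f x * (g x)^*%C).

Definition L2norm mu f : R :=
  Num.sqrt (Rintegral mu [set: T] (fun x => cabs (f x) ^+ 2)).

Definition L2continuous_on mu (D : set (T -> R[i])) (F : (T -> R[i]) -> R[i]) :=
  forall phi0, D phi0 -> forall eps : R, 0 < eps ->
  exists2 delta : R, 0 < delta &
    forall phi, D phi -> L2norm mu (fun x => phi x - phi0 x) < delta ->
      cabs (F phi - F phi0) < eps.

(* An operator A from L2(mu) to L2(nu) with domain D is given by its action
   on representatives. *)
Definition adjoint_dom mu nu (D : set (T -> R[i]))
    (A : (T -> R[i]) -> (T -> R[i])) : set (T -> R[i]) :=
  [set g | L2 nu g /\ L2continuous_on mu D (fun phi => L2inner nu (A phi) g)].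

(* The value of the adjoint at g is an element of L2(mu), hence a set of
   representatives: when D is dense in L2(mu) and g lies in adjoint_dom, it is
   exactly one mu-a.e. class. *)
Definition adjoint mu nu (D : set (T -> R[i]))
    (A : (T -> R[i]) -> (T -> R[i])) g : set (T -> R[i]) :=
  [set h | L2 mu h /\
           forall phi, D phi -> L2inner nu (A phi) g = L2inner mu phi h].

(* To be used with domain csimple; it maps the mu-class of phi to its
   nu-class, which is well defined when nu is dominated by mu. *)
Definition embedding phi : T -> R[i] := phi.

(* The library's derivative is \bar R-valued, with finite values everywhere
   as soon as nu `<< mu, so fine loses nothing. *)
Definition RN_derivative (mu nu : {finite_measure set T -> \bar R}) : T -> R[i] :=
  fun x => (fine (('d (charge_of_finite_measure nu) '/d mu) x))%:C.

End complex_L2.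

(* Main.v *)
(* Write h for dnu/dmu.  On simple functions the integral against nu is the
   L2(mu) pairing with h, so (i) gives (iv) by Cauchy-Schwarz, and (iv) is the
   boundedness of the linear form phi |-> \int phi dnu, i.e. its continuity.
   Continuity of the form attached to 1 passes to the form attached to any
   simple psi because psi is bounded.  For (iv) -> (i), let simple functions
   g_n >= 0 increase to h; then
     \int g_n^2 dmu <= \int g_n h dmu = \int g_n dnu
                   <= (C \int g_n^2 dmu)^(1/2),
   so \int g_n^2 dmu <= C, and monotone convergence bounds \int h^2 dmu. *)
Require Import Defs.
From HB Require Import structures.
From mathcomp Require Import all_boot all_order all_algebra.
From mathcomp Require Import complex.
From mathcomp Require Import all_classical all_reals all_analysis.
From mathcomp Require Import measurable_realfun.
From mathcomp Require Import ring lra.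
Import Order.TTheory GRing.Theory Num.Theory.

Local Open Scope classical_set_scope.
Local Open Scope ring_scope.
Local Open Scope charge_scope.

(** * Algebra and boundedness of complex simple functions *)

Section csimple_closure.
Context (d : measure_display) (T : measurableType d) (R : realType).
Implicit Types f g phi psi : T -> R[i].

Lemma cabs_sqr (z : R[i]) :
  cabs z ^+ 2 = complex.Re z ^+ 2 + complex.Im z ^+ 2.
Proof. by case: z => a b; rewrite /cabs /= sqr_sqrtr// addr_ge0 ?sqr_ge0. Qed.

Lemma cabs_ge0 (z : R[i]) : 0 <= cabs z.
Proof. by case: z => a b; rewrite /cabs /= sqrtr_ge0. Qed.

Lemma cabsM (z w : R[i]) : cabs (z * w) = cabs z * cabs w.
Proof. exact: ComplexField.Normc.normcM. Qed.

Lemma cabs_conj (z : R[i]) : cabs z^*%C = cabs z.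
Proof. by case: z => a b; rewrite /cabs /= sqrrN. Qed.

Lemma ReM (z w : R[i]) : complex.Re (z * w) =
  complex.Re z * complex.Re w - complex.Im z * complex.Im w.
Proof. by case: z; case: w. Qed.

Lemma ImM (z w : R[i]) : complex.Im (z * w) =
  complex.Re z * complex.Im w + complex.Im z * complex.Re w.
Proof. by case: z; case: w. Qed.

Lemma ReB (z w : R[i]) : complex.Re (z - w) = complex.Re z - complex.Re w.
Proof. by case: z; case: w. Qed.

Lemma ImB (z w : R[i]) : complex.Im (z - w) = complex.Im z - complex.Im w.
Proof. by case: z; case: w. Qed.

Lemma Re_conj (z : R[i]) : complex.Re z^*%C = complex.Re z.
Proof. by case: z. Qed.

Lemma Im_conj (z : R[i]) : complex.Im z^*%C = - complex.Im z.
Proof. by case: z. Qed.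

Lemma cmeasurableM f g : cmeasurable f -> cmeasurable g ->
  cmeasurable (fun x => f x * g x).
Proof.
move=> [mf1 mf2] [mg1 mg2]; split.
  under eq_fun do rewrite ReM.
  by apply: measurable_funB; exact: measurable_funM.
under eq_fun do rewrite ImM.
by apply: measurable_funD; exact: measurable_funM.
Qed.

Lemma cmeasurableB f g : cmeasurable f -> cmeasurable g ->
  cmeasurable (fun x => f x - g x).
Proof.
move=> [mf1 mf2] [mg1 mg2]; split.
  by under eq_fun do rewrite ReB; exact: measurable_funB.
by under eq_fun do rewrite ImB; exact: measurable_funB.
Qed.

Lemma cmeasurable_conj f : cmeasurable f -> cmeasurable (fun x => (f x)^*%C).
Proof.
move=> [mf1 mf2]; split; first by under eq_fun do rewrite Re_conj.
by under eq_fun do rewrite Im_conj; exact: measurableT_comp.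
Qed.

Lemma measurable_cabs_sqr f : cmeasurable f ->
  measurable_fun [set: T] (fun x => cabs (f x) ^+ 2).
Proof.
move=> [mf1 mf2]; under eq_fun do rewrite cabs_sqr.
by apply: measurable_funD; exact: measurable_funX.
Qed.

Lemma csimple_cst c : csimple (cst c : T -> R[i]).
Proof.
split; first by split; exact: measurable_cst.
by apply: sub_finite_set (finite_set1 c) => z [x _ <-].
Qed.

Lemma csimple_real (h : T -> R) : measurable_fun [set: T] h ->
  finite_set (range h) -> csimple (fun x => (h x)%:C%C).
Proof.
move=> mh fh; split; first by split => //; exact: measurable_cst.
apply: sub_finite_set (finite_image (fun r : R => r%:C%C) fh).
by move=> z [x _ <-]; exists (h x) => //; exists x.
Qed.

Lemma csimpleB f g : csimple f -> csimple g -> csimple (fun x => f x - g x).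
Proof.
move=> [mf ff] [mg fg]; split; first exact: cmeasurableB.
apply: sub_finite_set (finite_image2 (fun z w : R[i] => z - w) ff fg).
by move=> z [x _ <-]; exists (f x); [exists x|exists (g x) => //; exists x].
Qed.

Lemma csimpleM f g : csimple f -> csimple g -> csimple (fun x => f x * g x).
Proof.
move=> [mf ff] [mg fg]; split; first exact: cmeasurableM.
apply: sub_finite_set (finite_image2 (fun z w : R[i] => z * w) ff fg).
by move=> z [x _ <-]; exists (f x); [exists x|exists (g x) => //; exists x].
Qed.

Lemma csimple_conj f : csimple f -> csimple (fun x => (f x)^*%C).
Proof.
move=> [mf ff]; split; first exact: cmeasurable_conj.
apply: sub_finite_set (finite_image (fun z : R[i] => z^*%C) ff).
by move=> z [x _ <-]; exists (f x) => //; exists x.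
Qed.

(** The sum of the moduli over the finite range serves as bound: each value is one of the summands
    and the others are nonnegative. *)
Lemma csimple_bounded f : csimple f -> exists M, forall x, cabs (f x) <= M.
Proof.
move=> [_ /finite_seqP[s fs]]; exists (\sum_(z <- s) cabs z) => x.
have fxs : f x \in s by have : range f (f x) by [exists x]; rewrite fs.
by rewrite (big_rem _ fxs) /= lerDl sumr_ge0// => z _; exact: cabs_ge0.
Qed.

Lemma Re_csimple_bounded f : csimple f ->
  [bounded complex.Re (f x) | x in [set: T]].
Proof.
move=> /csimple_bounded[M fM]; exists M; split; first exact: num_real.
move=> r /ltW Mr x _; apply: le_trans Mr; apply: le_trans (fM x).
rewrite -(@ler_pXn2r _ 2) ?nnegrE ?cabs_ge0// cabs_sqr.
by rewrite real_normK ?num_real// lerDl sqr_ge0.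
Qed.

Lemma Im_csimple_bounded f : csimple f ->
  [bounded complex.Im (f x) | x in [set: T]].
Proof.
move=> /csimple_bounded[M fM]; exists M; split; first exact: num_real.
move=> r /ltW Mr x _; apply: le_trans Mr; apply: le_trans (fM x).
rewrite -(@ler_pXn2r _ 2) ?nnegrE ?cabs_ge0// cabs_sqr.
by rewrite real_normK ?num_real// lerDr sqr_ge0.
Qed.

End csimple_closure.

(** * Integrals and [L2norm] of simple functions for a finite measure *)

Section finite_measure_integrals.
Context (d : measure_display) (T : measurableType d) (R : realType).
Variable mu : {finite_measure set T -> \bar R}.
Implicit Types phi psi : T -> R[i].

Lemma integrable_Re_csimple phi : csimple phi ->
  mu.-integrable [set: T] (EFin \o (fun x => complex.Re (phi x))).
Proof.
move=> sphi; apply: measurable_bounded_integrable => //.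
- exact: fin_num_fun_lty.
- by case: sphi => -[].
- exact: Re_csimple_bounded.
Qed.

Lemma integrable_Im_csimple phi : csimple phi ->
  mu.-integrable [set: T] (EFin \o (fun x => complex.Im (phi x))).
Proof.
move=> sphi; apply: measurable_bounded_integrable => //.
- exact: fin_num_fun_lty.
- by case: sphi => -[].
- exact: Im_csimple_bounded.
Qed.

(** The squared modulus is the real part of the simple function [phi x * (phi x)^*%C], so the
    bounded case applies. *)
Lemma integrable_cabs_sqr_csimple phi : csimple phi ->
  mu.-integrable [set: T] (EFin \o (fun x => cabs (phi x) ^+ 2)).
Proof.
move=> sphi.
rewrite (_ : (fun x => _) = fun x => complex.Re (phi x * (phi x)^*%C)).
  exact/integrable_Re_csimple/csimpleM/csimple_conj.
apply/funext => x; rewrite cabs_sqr ReM Re_conj Im_conj; ring.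
Qed.

Lemma csimple_L2 phi : csimple phi -> L2 mu phi.
Proof.
move=> sphi; split; first by case: sphi.
have /integrableP[_] := integrable_cabs_sqr_csimple _ sphi.
by rewrite /=; under eq_integral => x _ do [rewrite ger0_norm ?sqr_ge0//].
Qed.

Lemma L2norm_sqr phi :
  L2norm mu phi ^+ 2 = Rintegral mu [set: T] (fun x => cabs (phi x) ^+ 2).
Proof.
by rewrite /L2norm sqr_sqrtr// Rintegral_ge0// => x _; exact: sqr_ge0.
Qed.

Lemma cintegralB phi psi : csimple phi -> csimple psi ->
  cintegral mu (fun x => phi x - psi x) = cintegral mu phi - cintegral mu psi.
Proof.
move=> sphi spsi; rewrite /cintegral.
under eq_Rintegral do rewrite ReB.
under [X in (_ +i* X)%C = _]eq_Rintegral do rewrite ImB.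
rewrite !RintegralB//; [exact: integrable_Im_csimple..| |];
  exact: integrable_Re_csimple.
Qed.

Lemma cintegralZ (r : R) phi : csimple phi ->
  cintegral mu (fun x => r%:C%C * phi x) = r%:C%C * cintegral mu phi.
Proof.
move=> sphi; rewrite /cintegral.
under eq_Rintegral do rewrite ReM/= mul0r subr0.
under [X in (_ +i* X)%C = _]eq_Rintegral do rewrite ImM/= mul0r addr0.
rewrite !RintegralZl//; [|exact: integrable_Im_csimple
  |exact: integrable_Re_csimple].
by apply/eqP; rewrite eq_complex /= !mul0r subr0 addr0 !eqxx.
Qed.

Lemma L2normZ (r : R) phi : csimple phi ->
  L2norm mu (fun x => r%:C%C * phi x) = `|r| * L2norm mu phi.
Proof.
move=> sphi; rewrite /L2norm.
under eq_Rintegral do rewrite cabsM exprMn.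
rewrite RintegralZl//; last exact: integrable_cabs_sqr_csimple.
rewrite sqrtrM ?sqr_ge0// sqrtr_sqr; congr (_ * _).
by rewrite /cabs /= expr0n addr0 sqrtr_sqr normr_id.
Qed.

(** Multiplication by a bounded simple function is continuous in the [L2norm]; this carries
    continuity from the form attached to 1 to the one attached to [psi]. *)
Lemma L2normM_le (M : R) phi psi : csimple phi -> csimple psi -> 0 <= M ->
  (forall x, cabs (psi x) <= M) ->
  L2norm mu (fun x => phi x * psi x) <= M * L2norm mu phi.
Proof.
move=> sphi spsi M0 psiM.
rewrite -(@ler_pXn2r _ 2) ?nnegrE ?mulr_ge0 ?sqrtr_ge0// exprMn !L2norm_sqr.
rewrite -RintegralZl//; last exact: integrable_cabs_sqr_csimple.
apply: le_Rintegral => //.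
- exact/integrable_cabs_sqr_csimple/csimpleM.
- have i2 := integrable_cabs_sqr_csimple _ sphi.
  by have := integrableZl measurableT (M ^+ 2) i2.
move=> x _; rewrite cabsM exprMn mulrC ler_wpM2r ?sqr_ge0//.
by rewrite ler_pXn2r ?nnegrE ?cabs_ge0.
Qed.

End finite_measure_integrals.

(** * The Cauchy-Schwarz inequality for real square-integrable functions *)

Section cauchy_schwarz.
Context (d : measure_display) (T : measurableType d) (R : realType).
Variable mu : {measure set T -> \bar R}.
Implicit Types f g : T -> R.

(** The product is dominated in absolute value by [f x ^+ 2 + g x ^+ 2]. *)
Lemma integrable_mul_sqr f g :
  measurable_fun [set: T] f -> measurable_fun [set: T] g ->
  mu.-integrable [set: T] (EFin \o (fun x => f x ^+ 2)) ->
  mu.-integrable [set: T] (EFin \o (fun x => g x ^+ 2)) ->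
  mu.-integrable [set: T] (EFin \o (fun x => f x * g x)).
Proof.
move=> mf mg if2 ig2; have := integrableD measurableT if2 ig2.
apply: le_integrable => //; first exact/measurable_EFinP/measurable_funM.
move=> x _ /=; rewrite lee_fin.
rewrite [leRHS]ger0_norm ?addr_ge0 ?sqr_ge0// ler_norml; apply/andP; split; nra.
Qed.

(** Discriminant argument: the integral of [(t * f x + g x) ^+ 2] is a nonnegative polynomial of
    degree at most 2 in [t]. *)
Lemma sqr_Rintegral_mul_le f g :
  measurable_fun [set: T] f -> measurable_fun [set: T] g ->
  mu.-integrable [set: T] (EFin \o (fun x => f x ^+ 2)) ->
  mu.-integrable [set: T] (EFin \o (fun x => g x ^+ 2)) ->
  Rintegral mu [set: T] (fun x => f x * g x) ^+ 2 <=
  Rintegral mu [set: T] (fun x => f x ^+ 2) *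
  Rintegral mu [set: T] (fun x => g x ^+ 2).
Proof.
move=> mf mg if2 ig2.
have ifg := integrable_mul_sqr _ _ mf mg if2 ig2.
set a := Rintegral _ _ (fun x => f x ^+ 2).
set c := Rintegral _ _ (fun x => g x ^+ 2).
set b := Rintegral _ _ _.
pose p : {poly R} := \poly_(i < 3) [:: c; 2 * b; a]`_i.
have p_ge0 t : 0 <= p.[t].
  rewrite horner_poly !big_ord_recr big_ord0 /= expr0 expr1 mulr1 add0r.
  have -> : c + 2 * b * t + a * t ^+ 2 =
      Rintegral mu [set: T] (fun x => (t * f x + g x) ^+ 2).
    transitivity (Rintegral mu [set: T]
        (fun x => t ^+ 2 * f x ^+ 2 + (2 * t * (f x * g x) + g x ^+ 2))).
      have i1 : mu.-integrable [set: T] (EFin \o (fun x => t ^+ 2 * f x ^+ 2)).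
        by have := integrableZl measurableT (t ^+ 2) if2.
      have i2 : mu.-integrable [set: T]
          (EFin \o (fun x => 2 * t * (f x * g x))).
        by have := integrableZl measurableT (2 * t) ifg.
      have i3 : mu.-integrable [set: T]
          (EFin \o (fun x => 2 * t * (f x * g x) + g x ^+ 2)).
        by have := integrableD measurableT i2 ig2.
      rewrite RintegralD// RintegralD// !RintegralZl//.
      rewrite -/a -/b -/c; ring.
    by apply: eq_Rintegral => x _; ring.
  by apply: Rintegral_ge0 => x _; exact: sqr_ge0.
(* Nonnegativity everywhere forces the discriminant [(2 * b) ^+ 2 - 4 * a * c] to be nonpositive;
   the degenerate case [a = 0] is covered as well. *)
have := deg_le2_poly_ge0 (size_poly _ _) p_ge0.
by rewrite !coef_poly /= exprMn => h; lra.
Qed.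

End cauchy_schwarz.

(** The usual equivalence of continuity and boundedness for a linear form: scaling turns continuity
    at 0 into a bound, and the bound applied to [phi - phi0] gives continuity. *)
Lemma L2continuous_on_csimpleP (d : measure_display) (T : measurableType d)
    (R : realType) (mu nu : {finite_measure set T -> \bar R}) :
  L2continuous_on mu (@csimple d T R) (cintegral nu) <->
  exists2 C : R, 0 <= C & forall phi : T -> R[i], csimple phi ->
    cabs (cintegral nu phi) ^+ 2 <=
    C * Rintegral mu [set: T] (fun x => cabs (phi x) ^+ 2).
Proof.
split=> [cont|[C C0 CP] phi0 sphi0 eps eps0].
  have cintegral0 : cintegral nu (cst 0 : T -> R[i]) = 0.
    by apply/eqP; rewrite eq_complex /= !Rintegral_cst// !mul0r eqxx.
  have [delta delta0 deltaP] := cont (cst 0) (csimple_cst _ _ _ 0) 1 ltr01.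
  (* Here [delta] answers the tolerance 1 at the origin, so the norm of the form is at most
     [delta^-1]. *)
  exists (delta ^- 2); first by rewrite invr_ge0 sqr_ge0.
  move=> phi sphi; rewrite -L2norm_sqr -exprVn -exprMn.
  rewrite ler_pXn2r ?nnegrE ?mulr_ge0 ?invr_ge0 ?sqrtr_ge0 ?cabs_ge0
    ?(ltW delta0)//.
  (* If the bound failed, dividing [phi] by the modulus [I] of its integral would give a simple
     function of norm less than [delta] whose integral has modulus 1, not less than 1. *)
  rewrite mulrC ler_pdivlMr// leNgt; apply/negP => lt_norm.
  set I := cabs _ in lt_norm.
  have I0 : 0 < I.
    rewrite -(pmulr_lgt0 _ delta0); apply: le_lt_trans lt_norm.
    exact: sqrtr_ge0.
  have /deltaP : csimple (fun x => (I^-1)%:C%C * phi x).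
    exact: csimpleM (csimple_cst _ _ _ _) sphi.
  under [X in L2norm _ X]eq_fun do rewrite subr0.
  rewrite L2normZ// gtr0_norm ?invr_gt0// mulrC ltr_pdivrMr// (mulrC delta).
  move=> /(_ lt_norm); rewrite cintegral0 subr0 cintegralZ// cabsM -/I.
  rewrite {1}/cabs /= expr0n addr0 sqrtr_sqr gtr0_norm ?invr_gt0//.
  by rewrite mulVf ?gt_eqF// ltxx.
(* [C] may be 0, so [C + 1] is used to have a positive denominator. *)
have C1 : 0 < C + 1 by rewrite ltr_wpDl.
exists (eps / Num.sqrt (C + 1)); first by rewrite divr_gt0 ?sqrtr_gt0.
move=> phi sphi; rewrite ltr_pdivlMr ?sqrtr_gt0// => lt_eps.
rewrite -cintegralB//; have := CP _ (csimpleB _ _ _ _ _ sphi sphi0).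
rewrite -L2norm_sqr => le_C.
rewrite -(@ltr_pXn2r _ 2) ?nnegrE ?cabs_ge0 ?(ltW eps0)//.
apply: le_lt_trans le_C _.
apply: (@le_lt_trans _ _ ((C + 1) * L2norm mu (fun x => phi x - phi0 x) ^+ 2)).
  by rewrite ler_wpM2r ?sqr_ge0// lerDl.
rewrite -[X in X * _]sqr_sqrtr ?(ltW C1)// -exprMn mulrC.
by rewrite ltr_pXn2r// nnegrE ?mulr_ge0 ?sqrtr_ge0 ?(ltW eps0).
Qed.

(** * Square integrability of the derivative versus the integral bound *)

Section radon_nikodym.
Context (d : measure_display) (T : measurableType d) (R : realType).
Variables mu nu : {finite_measure set T -> \bar R}.
Hypothesis numu : nu `<< mu.

Local Notation RN := (RN_derivative mu nu).
Local Notation dnu := ('d (charge_of_finite_measure nu) '/d mu).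

Lemma EFin_Re_RN : (fun x => (complex.Re (RN x))%:E) = dnu.
Proof. by apply/funext => x /=; rewrite fineK// Radon_Nikodym_fin_num. Qed.

Lemma cmeasurable_RN : cmeasurable RN.
Proof.
split; last exact: measurable_cst.
apply/measurable_EFinP; rewrite (_ : _ \o _ = dnu) -?EFin_Re_RN//.
by rewrite EFin_Re_RN.
Qed.

Lemma Rintegral_RN (f : T -> R) : nu.-integrable [set: T] (EFin \o f) ->
  Rintegral nu [set: T] f =
  Rintegral mu [set: T] (fun x => f x * complex.Re (RN x)).
Proof.
move=> intf; rewrite /Rintegral -(Radon_Nikodym_change_of_variables numu)//.
congr fine; apply: eq_integral => x _.
by rewrite EFinM -[in LHS]EFin_Re_RN.
Qed.

(** [RN] is real-valued, so the conjugation in the pairing is inert and the change of variables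
    applies to each part of [phi]. *)
Lemma cintegral_RN (phi : T -> R[i]) : csimple phi ->
  cintegral nu phi = L2inner mu phi RN.
Proof.
move=> sphi; rewrite /L2inner /cintegral.
rewrite Rintegral_RN ?Rintegral_RN; [|exact: integrable_Im_csimple
  |exact: integrable_Re_csimple].
congr (_ +i* _)%C; apply: eq_Rintegral => x _.
  by rewrite ReM Re_conj Im_conj /= oppr0 mulr0 subr0.
by rewrite ImM Re_conj Im_conj /= oppr0 mulr0 add0r.
Qed.

Lemma L2_RN_bound : L2 mu RN ->
  exists2 C : R, 0 <= C & forall phi : T -> R[i], csimple phi ->
    cabs (cintegral nu phi) ^+ 2 <=
    C * Rintegral mu [set: T] (fun x => cabs (phi x) ^+ 2).
Proof.
move=> [_ RN2].
(* The constant is the squared L2 norm of [RN], whose imaginary part is 0. *)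
exists (Rintegral mu [set: T] (fun x => complex.Re (RN x) ^+ 2)).
  by apply: Rintegral_ge0 => x _; exact: sqr_ge0.
move=> phi sphi.
have [[mRe mIm] _] := sphi.
have mRN := cmeasurable_RN.1.
have iRN2 : mu.-integrable [set: T] (EFin \o (fun x => complex.Re (RN x) ^+ 2)).
  apply/integrableP; split; first exact/measurable_EFinP/measurable_funX.
  rewrite (eq_integral (fun x => (cabs (RN x) ^+ 2)%:E))// => x _.
  by rewrite cabs_sqr /= expr0n addr0 ger0_norm ?sqr_ge0.
have iphi2 := integrable_cabs_sqr_csimple _ _ _ mu _ sphi.
have iRe2 : mu.-integrable [set: T]
    (EFin \o (fun x => complex.Re (phi x) ^+ 2)).
  apply: le_integrable iphi2 => //.
    exact/measurable_EFinP/measurable_funX.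
  move=> x _ /=; rewrite lee_fin !ger0_norm ?sqr_ge0// cabs_sqr.
  by rewrite lerDl sqr_ge0.
have iIm2 : mu.-integrable [set: T]
    (EFin \o (fun x => complex.Im (phi x) ^+ 2)).
  apply: le_integrable iphi2 => //.
    exact/measurable_EFinP/measurable_funX.
  move=> x _ /=; rewrite lee_fin !ger0_norm ?sqr_ge0// cabs_sqr.
  by rewrite lerDr sqr_ge0.
(* Both sides split into real and imaginary parts, and the real Cauchy-Schwarz inequality is applied
   to each. *)
under [X in _ <= _ * X]eq_Rintegral do rewrite cabs_sqr.
rewrite RintegralD// cabs_sqr /= mulrDr !Rintegral_RN;
  [|exact: integrable_Im_csimple|exact: integrable_Re_csimple].
by apply: lerD; rewrite [leRHS]mulrC; exact: sqr_Rintegral_mul_le.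
Qed.

Import HBNNSimple.

(** Testing the bound on [g] itself gives [b ^+ 2 <= C * a], with [a] the [mu]-integral of the
    square of [g] and [b] the [nu]-integral of [g]; since [g] lies below the derivative, also
    [a <= b]. *)
Lemma integral_nnsfun_sqr_le (C : R) (g : {nnsfun T >-> R}) : 0 <= C ->
  (forall phi : T -> R[i], csimple phi -> cabs (cintegral nu phi) ^+ 2 <=
    C * Rintegral mu [set: T] (fun x => cabs (phi x) ^+ 2)) ->
  (forall x, ((g x)%:E <= Radon_Nikodym_SigmaFinite.f nu mu x)%E) ->
  (\int[mu]_x (g x ^+ 2)%:E <= C%:E)%E.
Proof.
move=> C0 CP gf.
have mg : measurable_fun [set: T] g by exact: measurable_funPT.
have sg := csimple_real _ _ _ _ mg (fimfunP g).
have gE : (fun x => cabs (g x)%:C%C ^+ 2) = fun x => g x ^+ 2.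
  by apply/funext => x; rewrite cabs_sqr /= expr0n addr0.
have := CP _ sg; rewrite gE cabs_sqr /= Rintegral_cst// mul0r expr0n addr0.
set b := Rintegral nu _ _; set a := Rintegral mu _ _.
have ig2 : mu.-integrable [set: T] (EFin \o (fun x => g x ^+ 2)).
  by rewrite -gE; exact: integrable_cabs_sqr_csimple.
have ig : nu.-integrable [set: T] (EFin \o g).
  exact: integrable_Re_csimple sg.
have aE : (\int[mu]_x (g x ^+ 2)%:E)%E = a%:E.
  by rewrite fineK//; exact: integrable_fin_num ig2.
have bE : (\int[nu]_x (g x)%:E)%E = b%:E.
  by rewrite fineK//; exact: integrable_fin_num ig.
(* After the change of variables this is the pointwise inequality between [g * g] and [g] times the
   derivative, integrated against [mu]. *)
have ab : a <= b.
  rewrite -lee_fin -aE -bE.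
  rewrite -(Radon_Nikodym_SigmaFinite.change_of_variables numu)//;
    [|by move=> x; rewrite lee_fin|exact/measurable_EFinP].
  apply: ge0_le_integral => //.
  - by move=> x _; rewrite lee_fin sqr_ge0.
  - exact/measurable_EFinP/measurable_funX.
  - apply: emeasurable_funM; first exact/measurable_EFinP.
    exact/measurable_int/Radon_Nikodym_SigmaFinite.f_integrable.
  - by move=> x _; rewrite expr2 EFinM lee_wpmul2l ?lee_fin.
have a0 : 0 <= a by apply: Rintegral_ge0 => x _; exact: sqr_ge0.
(* If [C < a], then [a] is positive and [b ^+ 2 <= C * a < a ^+ 2 <= b ^+ 2], a contradiction. *)
move=> bCa; rewrite aE lee_fin leNgt; apply/negP => Ca; nra.
Qed.

(* The sigma-finite derivative Radon_Nikodym_SigmaFinite.f is a version of dnu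
   that is nonnegative everywhere, as the approximation from below requires. *)
Lemma bound_L2_RN (C : R) : 0 <= C ->
  (forall phi : T -> R[i], csimple phi -> cabs (cintegral nu phi) ^+ 2 <=
    C * Rintegral mu [set: T] (fun x => cabs (phi x) ^+ 2)) ->
  L2 mu RN.
Proof.
move=> C0 CP; split; first exact: cmeasurable_RN.
pose f := Radon_Nikodym_SigmaFinite.f nu mu.
have f0 x : (0 <= f x)%E by exact: Radon_Nikodym_SigmaFinite.f_ge0.
have mf : measurable_fun [set: T] f.
  exact/measurable_int/Radon_Nikodym_SigmaFinite.f_integrable.
have mdnu : measurable_fun [set: T] dnu.
  exact/measurable_int/Radon_Nikodym_integrable.
(* Almost everywhere equality of [dnu] and [f] passes to their squares, hence to the integrals. *)
have -> : (\int[mu]_x (cabs (RN x) ^+ 2)%:E = \int[mu]_x (f x * f x))%E.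
  transitivity (\int[mu]_x (dnu x * dnu x))%E.
    apply: eq_integral => x _; rewrite cabs_sqr /= expr0n addr0.
    by rewrite expr2 EFinM -[in RHS]EFin_Re_RN.
  apply: ae_eq_integral => //; [exact: emeasurable_funM..|].
  apply: ae_eq_comp (fun y : \bar R => (y * y)%E) _ _ _.
  exact/ae_eq_sym/ae_eq_Radon_Nikodym_SigmaFinite.
pose g := nnsfun_approx measurableT mf.
have mg n : measurable_fun [set: T] (fun x => (g n x ^+ 2)%:E).
  exact/measurable_EFinP/measurable_funX/measurable_funPT.
have g0 n x : [set: T] x -> (0 <= (g n x ^+ 2)%:E)%E.
  by move=> _; rewrite lee_fin sqr_ge0.
have ndg x : [set: T] x ->
    {homo (fun n => (g n x ^+ 2)%:E) : n m / (n <= m)%N >-> (n <= m)%E}.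
  move=> _ n m nm; rewrite lee_fin ler_pXn2r ?nnegrE//.
  exact/lefP/nd_nnsfun_approx.
(* Finiteness of [f x] reduces the limit to one in [R], where multiplication is continuous. *)
have flim x : [set: T] x -> (f x * f x)%E = limn (fun n => (g n x ^+ 2)%:E).
  move=> _; apply/esym/cvg_lim => //.
  have : f x \is a fin_num by exact: Radon_Nikodym_SigmaFinite.f_fin_num.
  have := cvg_nnsfun_approx measurableT mf (fun x _ => f0 x) (I : setT x).
  rewrite -/g; case: (f x) => // r /fine_cvgP[_ gr] _.
  by apply: cvg_EFin; [exact: nearW|exact: cvgM].
under eq_integral => x /set_mem xT do rewrite flim//.
rewrite (monotone_convergence mu measurableT mg g0 ndg).
apply: le_lt_trans (ltry C); apply: lime_le.
  apply: ereal_nondecreasing_is_cvgn => n m nm.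
  by apply: ge0_le_integral => //; [exact: g0|move=> x xT; exact: ndg].
apply: nearW => n; apply: integral_nnsfun_sqr_le => // x.
by rewrite nnsfun_approxE; exact: le_approx.
Qed.

End radon_nikodym.

(** * The value of the adjoint at 1 *)

Section adjoint_one.
Context (d : measure_display) (T : measurableType d) (R : realType).
Variables mu nu : {finite_measure set T -> \bar R}.
Hypothesis numu : nu `<< mu.

Local Notation RN := (RN_derivative mu nu).

(** A dominating function for both parts of [g], as a real number is at most 1 plus its square; the
    constant 1 is integrable because [mu] is finite. *)
Lemma integrable_1Dcabs_sqr (g : T -> R[i]) : L2 mu g ->
  mu.-integrable [set: T] (EFin \o (fun x => 1 + cabs (g x) ^+ 2)).
Proof.
move=> [mg g2].
have i1 := finite_measure_integrable_cst mu 1 (@measurableT _ T).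
have i2 : mu.-integrable [set: T] (EFin \o (fun x => cabs (g x) ^+ 2)).
  apply/integrableP; split; first exact/measurable_EFinP/measurable_cabs_sqr.
  rewrite (eq_integral (fun x => (cabs (g x) ^+ 2)%:E))// => x _.
  by rewrite /= ger0_norm ?sqr_ge0.
by have := integrableD measurableT i1 i2.
Qed.

Lemma L2_integrable_Re (g : T -> R[i]) : L2 mu g ->
  mu.-integrable [set: T] (fun x => (complex.Re (g x))%:E).
Proof.
move=> g2; apply: le_integrable (integrable_1Dcabs_sqr _ g2) => //.
  by apply/measurable_EFinP; case: g2 => -[].
move=> x _; rewrite lee_fin cabs_sqr [leRHS]ger0_norm; last first.
  by rewrite !addr_ge0 ?sqr_ge0.
rewrite ler_norml; apply/andP; split; nra.
Qed.

Lemma L2_integrable_Im (g : T -> R[i]) : L2 mu g ->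
  mu.-integrable [set: T] (fun x => (complex.Im (g x))%:E).
Proof.
move=> g2; apply: le_integrable (integrable_1Dcabs_sqr _ g2) => //.
  by apply/measurable_EFinP; case: g2 => -[].
move=> x _; rewrite lee_fin cabs_sqr [leRHS]ger0_norm; last first.
  by rewrite !addr_ge0 ?sqr_ge0.
rewrite ler_norml; apply/andP; split; nra.
Qed.

(** Brings an integral over [A] into the shape produced by pairing with the indicator of [A]. *)
Lemma integral_indic_Rintegral (f : T -> R) (A : set T) : measurable A ->
  mu.-integrable [set: T] (EFin \o f) ->
  (\int[mu]_(x in A) (f x)%:E =
   (Rintegral mu [set: T] (fun x => \1_A x * f x))%:E)%E.
Proof.
move=> mA intf.
have intfA : mu.-integrable A (EFin \o f) by exact: integrableS intf.
rewrite -[LHS]fineK; last exact: integrable_fin_num intfA.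
congr EFin; rewrite -[LHS]/(Rintegral mu A f) Rintegral_mkcond.
apply: eq_Rintegral => x _; rewrite patchE indicE.
by case: (x \in A); rewrite ?mul1r ?mul0r.
Qed.

(** Uniqueness of the adjoint value. Indicators, and their multiples by i, are simple; pairing with
    them equates the integrals of the real and imaginary parts over every measurable set, which
    determines both parts almost everywhere. *)
Lemma L2inner_orth_ae_eq (f g : T -> R[i]) : L2 mu f -> L2 mu g ->
  (forall phi, csimple phi -> L2inner mu phi f = L2inner mu phi g) ->
  f = g %[ae mu].
Proof.
move=> f2 g2 fg.
have sA (A : set T) : measurable A ->
    csimple (fun x => (\1_A x : R)%:C%C).
  move=> mA; apply: csimple_real; first exact: measurable_indic.
  apply: (@sub_finite_set _ _ [set 0; 1]); last exact: finite_set2.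
  by move=> _ [x _ <-]; rewrite indicE; case: (x \in A); [right|left].
have eqRe : ae_eq mu [set: T] (fun x => (complex.Re (f x))%:E)
    (fun x => (complex.Re (g x))%:E).
  apply: integral_ae_eq => //; first exact: L2_integrable_Re.
    exact/measurable_int/L2_integrable_Re.
  move=> A _ mA; rewrite !integral_indic_Rintegral//;
    [|exact: L2_integrable_Re..].
  congr EFin; have := congr1 (@complex.Re R) (fg _ (sA A mA)).
  rewrite /L2inner /cintegral /=.
  under eq_Rintegral do rewrite ReM Re_conj /= mul0r subr0.
  by under [in RHS]eq_Rintegral do rewrite ReM Re_conj /= mul0r subr0.
have eqIm : ae_eq mu [set: T] (fun x => (complex.Im (f x))%:E)
    (fun x => (complex.Im (g x))%:E).
  apply: integral_ae_eq => //; first exact: L2_integrable_Im.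
    exact/measurable_int/L2_integrable_Im.
  move=> A _ mA; rewrite !integral_indic_Rintegral//;
    [|exact: L2_integrable_Im..].
  (* Testing against i * 1_A moves Im into the real part of the pairing. *)
  have siA := csimpleM _ _ _ _ _ (csimple_cst _ _ _ (0 +i* 1)%C) (sA A mA).
  congr EFin; have := congr1 (@complex.Re R) (fg _ siA).
  rewrite /L2inner /cintegral /=.
  have Re_iA (h : T -> R[i]) x : complex.Re ((0 +i* 1)%C *
      (\1_A x : R)%:C%C * (h x)^*%C) = \1_A x * complex.Im (h x).
    by rewrite !ReM !ImM Re_conj Im_conj /=; ring.
  under eq_Rintegral do rewrite Re_iA.
  by under [in RHS]eq_Rintegral do rewrite Re_iA.
apply: filterS2 eqRe eqIm => x Rex Imx xT.
apply/eqP; rewrite eq_complex; apply/andP; split; apply/eqP.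
  by case: (Rex xT).
by case: (Imx xT).
Qed.

Lemma ae_eq_L2inner (phi f g : T -> R[i]) : cmeasurable phi ->
  cmeasurable f -> cmeasurable g -> f = g %[ae mu] ->
  L2inner mu phi f = L2inner mu phi g.
Proof.
move=> mphi mf mg fg; rewrite /L2inner /cintegral.
have [mf1 mf2] := cmeasurableM _ _ _ _ _ mphi (cmeasurable_conj _ _ _ _ mf).
have [mg1 mg2] := cmeasurableM _ _ _ _ _ mphi (cmeasurable_conj _ _ _ _ mg).
congr (_ +i* _)%C; congr fine; apply: ae_eq_integral => //;
  by [exact/measurable_EFinP|apply: filterS fg => x fgx xT; rewrite fgx].
Qed.

(** On simple functions, pairing with 1 under [nu] is pairing with [RN] under [mu]. One inclusion is
    then uniqueness of the representing class, the other the invariance of the pairing under almost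
    everywhere equality. *)
Lemma adjoint_embedding_one : L2 mu RN ->
  adjoint mu nu (@csimple d T R) (@embedding d T R) (cst 1) = L2class mu RN.
Proof.
move=> RN2.
have inner1 (phi : T -> R[i]) : csimple phi ->
    L2inner nu (embedding phi) (cst 1) = L2inner mu phi RN.
  move=> sphi; rewrite -cintegral_RN// /L2inner /embedding.
  by congr cintegral; apply/funext => x; rewrite conjc1 mulr1.
apply/seteqP; split => g [g2 gP]; split => //.
  by apply: L2inner_orth_ae_eq => // phi sphi; rewrite -gP// inner1.
move=> phi sphi; rewrite inner1//; apply/esym/ae_eq_L2inner => //.
- by case: sphi.
- by case: g2.
- by case: RN2.
Qed.

End adjoint_one.

(** The form attached to [psi] is integration against [nu] precomposed with multiplication by the
    conjugate of [psi], which preserves simple functions and is bounded in the [L2norm]. *)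
Lemma adjoint_dom_csimple (d : measure_display) (T : measurableType d)
    (R : realType) (mu nu : {finite_measure set T -> \bar R})
    (psi : T -> R[i]) :
  csimple psi -> L2continuous_on mu (@csimple d T R) (cintegral nu) ->
  adjoint_dom mu nu (@csimple d T R) (@embedding d T R) psi.
Proof.
move=> spsi cont; split; first exact: csimple_L2.
have [M psiM] := csimple_bounded _ _ _ _ spsi.
have spsiC := csimple_conj _ _ _ _ spsi.
move=> phi0 sphi0 eps eps0.
have [delta delta0 deltaP] := cont _ (csimpleM _ _ _ _ _ sphi0 spsiC) eps eps0.
(* The bound [M] carries no sign information, hence this positive replacement. *)
have M0 : 0 < `|M| + 1 by rewrite ltr_wpDl.
exists (delta / (`|M| + 1)); first by rewrite divr_gt0.
move=> phi sphi; rewrite ltr_pdivlMr// mulrC => lt_delta.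
apply: deltaP; first exact: csimpleM.
under [X in L2norm _ X]eq_fun do rewrite -mulrBl.
apply: le_lt_trans lt_delta; apply: L2normM_le => //; first exact: csimpleB.
move=> x; rewrite cabs_conj; apply: le_trans (psiM x) _.
by rewrite (le_trans (ler_norm M))// lerDl.
Qed.

Theorem proposition4p3 (d : measure_display) (T : measurableType d)
    (R : realType) (mu nu : {finite_measure set T -> \bar R})
    (numu : content_dominates mu nu) :
  let D := @csimple d T R in
  let J := @embedding d T R in
  let domJstar := adjoint_dom mu nu D J in
  let Jstar := adjoint mu nu D J in
  let one : T -> R[i] := cst 1 in
  [<-> L2 mu (RN_derivative mu nu);
       domJstar one;
       D `<=` domJstar;
       exists2 C : R, 0 <= C &
         forall phi : T -> R[i], D phi ->
           cabs (cintegral nu phi) ^+ 2 <=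
             C * Rintegral mu [set: T] (fun x => cabs (phi x) ^+ 2)]
  /\ (domJstar one -> Jstar one = L2class mu (RN_derivative mu nu)).
Proof.
move: numu => /null_content_dominatesP numu D J domJstar Jstar one.
(* The form attached to 1 is integration against [nu]; its continuity on [D] is the pivot through
   which the implications pass. *)
have inner1 : (fun phi => L2inner nu (J phi) one) = cintegral nu.
  apply/funext => phi; rewrite /L2inner /J /embedding /one.
  by congr cintegral; apply/funext => x; rewrite conjc1 mulr1.
have s1 : D one by exact: csimple_cst.
have dom_of_cont psi : L2continuous_on mu D (cintegral nu) -> D psi ->
    domJstar psi.
  by move=> cont spsi; exact: adjoint_dom_csimple.
have cont_of_dom : domJstar one -> L2continuous_on mu D (cintegral nu).
  by case=> _; rewrite inner1.
have RN_of_cont : L2continuous_on mu D (cintegral nu) ->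
    L2 mu (RN_derivative mu nu).
  by move=> /L2continuous_on_csimpleP[C C0 CP]; exact: bound_L2_RN CP.
split; last by move=> /cont_of_dom/RN_of_cont; exact: adjoint_embedding_one.
tfae.
- move=> RN2; apply: dom_of_cont s1.
  exact/L2continuous_on_csimpleP/L2_RN_bound.
- by move=> /cont_of_dom cont psi; exact: dom_of_cont.
- by move=> /(_ _ s1)/cont_of_dom/L2continuous_on_csimpleP.
- by move=> /L2continuous_on_csimpleP.
Qed.
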